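(* Let $k$ be an arbitrary field, let $m \geq 4$ be an integer, and let $n = 2m+1$. Assume that if $p$ denotes the characteristic of $k$, then $p \nmid m$ (this holds automatically when $p=0$). Let $A = k[s,x,y]$ be the polynomial ring in three variables, let $\mathfrak{m} = (s,x,y) \subseteq A$, let $$g = xy(x-y)(x+y-sy) \in A, \qquad \mathfrak{e} = (x^n, y^n, g) \subseteq A, \qquad f = \sum_{j=2}^{n-1} (-1)^j x^{n+1-j} y^j \in A,$$ and let $\mathfrak{h} = \mathfrak{e} + (f)$ and $\mathfrak{b} = (x,y)^{n+2}$, ideals of $A$. Then: (1) $\mathfrak{b} \subseteq \mathfrak{e}$; (2) $sf \in \mathfrak{e}$ (hence $\mathfrak{h} \subseteq (\mathfrak{e} : s)$); (3) $xf \in \mathfrak{e}$ and $yf \in \mathfrak{e}$ (hence $\mathfrak{m} \subseteq (\mathfrak{e} : f)$); (4) $f \notin \mathfrak{e}$ (hence $(\mathfrak{e} : f) \neq A$, so that $\mathfrak{m} = (\mathfrak{e} : f)$); (5) $\mathfrak{h}$ is $s$-saturated, that is, $(\mathfrak{h} : s) = \mathfrak{h}$; (6) $\mathfrak{e} : \mathfrak{m}^\infty = \mathfrak{e} : s^\infty = \mathfrak{h}$; (7) $H^0_{\mathfrak{m}}(A/\mathfrak{e}) \cong A/\mathfrak{m}$ as $A$-modules.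
   Context: For an ideal $\mathfrak{a}$ of $A$ and $u \in A$, $(\mathfrak{a} : u) = \{a \in A : au \in \mathfrak{a}\}$; $\mathfrak{a} : s^\infty = \bigcup_{i \geq 1} (\mathfrak{a} : s^i)$ and $\mathfrak{a} : \mathfrak{m}^\infty = \bigcup_{i \geq 1} (\mathfrak{a} : \mathfrak{m}^i)$. For an $A$-module $M$, $H^0_{\mathfrak{m}}(M) = \{z \in M : \mathfrak{m}^i z = 0 \text{ for some } i \geq 1\}$ is the $\mathfrak{m}$-torsion submodule (zeroth local cohomology). *)

(* Defs.v *)
From HB Require Import structures.
From mathcomp Require Import all_boot all_order all_algebra.
From mathcomp Require Import generic_quotient ring_quotient.
From mathcomp Require Import boolp.
From mathcomp Require Export mpoly.

Set Implicit Arguments.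
Unset Strict Implicit.
Unset Printing Implicit Defensive.

Import GRing.Theory.
Local Open Scope ring_scope.
Local Open Scope quotient_scope.

(* An ideal of [A] is a submodule of the regular module [A^o]. *)
Notation ideal A := (submodClosed A^o).

Section QuotientModule.
Variables (R : nzRingType) (V : lmodType R) (S : submodClosed V).

(* [submodClosed] does not carry closure under opposite, which [{ideal_quot _}] needs
   but which is automatic for modules over a ring. *)
Definition zsubmod : {pred V} := S.
HB.instance Definition _ :=
  GRing.isZmodClosed.Build V zsubmod (GRing.submod_closedB (submodClosedP S)).

Definition quotmod : Type := {ideal_quot zsubmod}.

HB.instance Definition _ := GRing.Zmodule.on quotmod.
HB.instance Definition _ := EqQuotient.on quotmod.

Definition quotmod_scale (a : R) (z : quotmod) : quotmod :=
  \pi_quotmod (a *: repr z).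

Lemma quotmod_piP (x y : V) :
  (\pi_quotmod x == \pi_quotmod y) = (x - y \in S).
Proof. exact: (esym (Quotient.idealrBE zsubmod x y)). Qed.

Lemma quotmod_piD (x y : V) :
  \pi_quotmod (x + y) = \pi_quotmod x + \pi_quotmod y.
Proof. exact: (@pi_addr _ _ _ _ _ {ideal_quot zsubmod}). Qed.

Lemma quotmod_pi_scale a (x : V) :
  \pi_quotmod (a *: x) = quotmod_scale a (\pi_quotmod x).
Proof.
apply/eqP; rewrite quotmod_piP -scalerBr.
by apply: rpredZ; rewrite -quotmod_piP reprK.
Qed.

Fact quotmod_scaleA a b z :
  quotmod_scale a (quotmod_scale b z) = quotmod_scale (a * b) z.
Proof.
by rewrite -[z]reprK -(quotmod_pi_scale b) -!(quotmod_pi_scale _ _) scalerA.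
Qed.

Fact quotmod_scale1 : left_id 1 quotmod_scale.
Proof. by move=> z; rewrite -[z]reprK -quotmod_pi_scale scale1r. Qed.

Fact quotmod_scaleDr : right_distributive quotmod_scale +%R.
Proof.
move=> a y z; rewrite -[y]reprK -[z]reprK -quotmod_piD.
by rewrite -!(quotmod_pi_scale a) scalerDr quotmod_piD.
Qed.

Fact quotmod_scaleDl z : {morph quotmod_scale^~ z : a b / a + b}.
Proof.
move=> a b; rewrite -[z]reprK.
by rewrite -!(quotmod_pi_scale _ (repr z)) scalerDl quotmod_piD.
Qed.

HB.instance Definition _ := GRing.Zmodule_isLmodule.Build R quotmod
  quotmod_scaleA quotmod_scale1 quotmod_scaleDr quotmod_scaleDl.

End QuotientModule.

Section SubmoduleType.
Variables (R : nzRingType) (V : lmodType R) (S : submodClosed V).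

Record submod_type := SubMod { submod_val :> V; _ : submod_val \in S }.

HB.instance Definition _ := [isSub for submod_val].
HB.instance Definition _ := [Choice of submod_type by <:].
HB.instance Definition _ := [SubChoice_isSubLmodule of submod_type by <:].

End SubmoduleType.

Section Ideals.
Variable A : comNzRingType.
Implicit Types (I J : ideal A) (s : seq A) (a b u : A).

Lemma ideal0 I : (0 : A) \in I. Proof. exact: (@rpred0 A^o I). Qed.

Lemma idealD I a b : a \in I -> b \in I -> a + b \in I.
Proof. exact: (@rpredD A^o I). Qed.

Lemma idealM I a b : b \in I -> a * b \in I.
Proof. exact: (@rpredZ A A^o I a b). Qed.

Section Generated.
Variable s : seq A.

Definition ideal_gen_pred : {pred A^o} :=
  fun a => `[< exists c : 'I_(size s) -> A, a = \sum_i c i * s`_i >].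

Fact ideal_gen_closed : submod_closed ideal_gen_pred.
Proof.
split=> [|r a b /asboolP[c ->] /asboolP[d ->]]; apply/asboolP.
  by exists (fun=> 0); rewrite big1 // => i _; rewrite mul0r.
exists (fun i => r * c i + d i).
rewrite /GRing.scale /= mulr_sumr -big_split.
by apply: eq_bigr => i _; rewrite mulrDl mulrA.
Qed.
HB.instance Definition _ :=
  GRing.isSubmodClosed.Build A A^o ideal_gen_pred ideal_gen_closed.

Definition ideal_gen : ideal A := ideal_gen_pred.
End Generated.

Section Sum.
Variables I J : ideal A.

Definition ideal_add_pred : {pred A^o} :=
  fun a => `[< exists b c, [/\ b \in I, c \in J & a = b + c] >].

Fact ideal_add_closed : submod_closed ideal_add_pred.
Proof.
split=> [|r _ _ /asboolP[a [b [aI bJ ->]]] /asboolP[c [d [cI dJ ->]]]].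
  by apply/asboolP; exists 0, 0; split; [exact: ideal0 | exact: ideal0 | rewrite addr0].
apply/asboolP; exists (r * a + c), (r * b + d); split.
- exact/idealD/cI/idealM.
- exact/idealD/dJ/idealM.
by rewrite addrACA -mulrDr.
Qed.
HB.instance Definition _ :=
  GRing.isSubmodClosed.Build A A^o ideal_add_pred ideal_add_closed.

Definition ideal_add : ideal A := ideal_add_pred.
End Sum.

Section Product.
Variables I J : ideal A.

Definition ideal_mul_pred : {pred A^o} :=
  fun a => `[< exists2 l : seq (A * A),
    {in l, forall p, p.1 \in I /\ p.2 \in J} & a = \sum_(p <- l) p.1 * p.2 >].

Fact ideal_mul_closed : submod_closed ideal_mul_pred.
Proof.
split=> [|r _ _ /asboolP[l1 l1P ->] /asboolP[l2 l2P ->]]; apply/asboolP.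
  by exists [::]; rewrite ?big_nil.
exists ([seq (r * p.1, p.2) | p <- l1] ++ l2).
  move=> p; rewrite mem_cat => /orP[/mapP[q /l1P[qI qJ] ->]|/l2P//].
  by split=> //; exact: idealM.
rewrite big_cat big_map /GRing.scale /= mulr_sumr.
by congr (_ + _); apply: eq_bigr => p _; rewrite mulrA.
Qed.
HB.instance Definition _ :=
  GRing.isSubmodClosed.Build A A^o ideal_mul_pred ideal_mul_closed.

Definition ideal_mul : ideal A := ideal_mul_pred.
End Product.

(* [I ^ 0] is the unit ideal. *)
Definition ideal_exp I (i : nat) : ideal A :=
  iter i (ideal_mul I) (ideal_gen [:: 1]).

(* The ideal quotients [(I : u)] and [(I : J)]; below, their saturations
   [I : u^oo] and [I : J^oo], as unions over exponents [i >= 1]. *)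
Definition colon I u : {pred A} := fun a => a * u \in I.

Definition colonI I J : {pred A} :=
  fun a => `[< forall b, b \in J -> a * b \in I >].

Definition satur I u : {pred A} :=
  fun a => `[< exists2 i : nat, (0 < i)%N & a \in colon I (u ^+ i) >].

Definition saturI I J : {pred A} :=
  fun a => `[< exists2 i : nat, (0 < i)%N & a \in colonI I (ideal_exp J i) >].

Lemma ideal_exp_le I (i j : nat) :
  (i <= j)%N -> {subset ideal_exp I j <= ideal_exp I i}.
Proof.
move=> /subnK <-; elim: (j - i)%N => [//|d IHd] a.
rewrite addSn /= => /asboolP[l lP ->]; apply: IHd.
elim: l lP => [|p l IHl] lP; first by rewrite big_nil ideal0.
rewrite big_cons idealD //.
  by have [_ pJ] := lP p (mem_head _ _); exact: idealM.
by apply: IHl => q ql; apply: lP; rewrite inE ql orbT.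
Qed.

Section Torsion.
Variables (I : ideal A) (M : lmodType A).

Definition torsion_pred : {pred M} := fun z =>
  `[< exists2 i : nat, (0 < i)%N & forall a, a \in ideal_exp I i -> a *: z = 0 >].

Fact torsion_closed : submod_closed torsion_pred.
Proof.
split=> [|r y z /asboolP[i i0 iP] /asboolP[j _ jP]]; apply/asboolP.
  by exists 1%N => // a _; rewrite scaler0.
exists (maxn i j) => [|a aI]; first by rewrite leq_max i0.
rewrite scalerDr scalerA mulrC -scalerA iP ?jP ?scaler0 ?addr0 //.
  exact: ideal_exp_le (leq_maxr i j) _ aI.
exact: ideal_exp_le (leq_maxl i j) _ aI.
Qed.
HB.instance Definition _ :=
  GRing.isSubmodClosed.Build A M torsion_pred torsion_closed.

(* The zeroth local cohomology module of [M] with support in [I]. *)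
Definition torsion : submodClosed M := torsion_pred.
End Torsion.

End Ideals.

Notation H0 I M := (submod_type (torsion I M)).

(* Main.v *)
Require Import Defs.
From HB Require Import structures.
From mathcomp Require Import all_boot all_order all_algebra.
From mathcomp Require Import generic_quotient boolp ring zify.
Import GRing.Theory.
Local Open Scope ring_scope.

Set Implicit Arguments.
Unset Strict Implicit.
Unset Printing Implicit Defensive.

(** Write t = 1 - s, so that g = xy(x - y)(x + ty) is a product of four lines over
    k[s], and everything is homogeneous in x, y over k[s].  Modulo e, the relation
    x^3 y = s x^2 y^2 + (1 - s) x y^3 kills all forms of degree at least n + 2, and in
    degree n + 1 every form is a multiple of E = x^2 y^(n-1); with
    tau = 1 + t^2 + ... + t^(2(m-1)) one gets f = tau E and s tau E = 0, whence s f = 0.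

    Conversely, dividing by g puts every polynomial in the form
    P(x) + y Q0(y) + x y Q1(y) + x^2 y Q2(y) with coefficients in k[s].  The restrictions
    to the four lines, read degree by degree, determine these coefficients; on h they
    vanish in degrees less than n, and in degree n + 1 a linear combination of them takes
    values in t(1 + t) tau k[s] on h and in t(1 + t) s tau k[s] on e.  This shows that f is
    not in e, and that h is s-saturated because tau takes the value m, nonzero in k,
    at s = 0.  Finally H^0_m(A/e) = h/e is generated by f, with annihilator (e : f) = m. *)

(** * Finitely generated ideals, colon ideals and torsion of quotient modules *)

Section Ideals.
Variable A : comNzRingType.
Implicit Types (I J : ideal A) (a b p q r : A).

Lemma idealB I a b : a \in I -> b \in I -> a - b \in I.
Proof. by move=> aI bI; rewrite -mulN1r idealD // idealM. Qed.

Lemma ideal_eqmod I a b : a - b \in I -> (a \in I) = (b \in I).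
Proof.
move=> abI; apply/idP/idP => [aI|bI]; last by rewrite -(subrK b a) idealD.
by rewrite -(subKr a b) idealB.
Qed.

Lemma mem_gen1 p a : reflect (exists u, a = u * p) (a \in ideal_gen [:: p]).
Proof.
apply: (iffP (asboolP _)) => [[c ->]|[u ->]]; last first.
  by exists (fun=> u); rewrite big_ord1.
by exists (c ord0); rewrite big_ord1.
Qed.

Lemma mem_gen2 p q a :
  reflect (exists u v, a = u * p + v * q) (a \in ideal_gen [:: p; q]).
Proof.
apply: (iffP (asboolP _)) => [[c ->]|[u [v ->]]].
  by exists (c ord0), (c (lift ord0 ord0)); rewrite big_ord_recl big_ord1.
by exists (fun i => [:: u; v]`_i); rewrite big_ord_recl big_ord1.
Qed.

Lemma mem_gen3 p q r a :
  reflect (exists u v w, a = u * p + v * q + w * r) (a \in ideal_gen [:: p; q; r]).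
Proof.
apply: (iffP (asboolP _)) => [[c ->]|[u [v [w ->]]]].
  exists (c ord0), (c (lift ord0 ord0)), (c (lift ord0 (lift ord0 ord0))).
  by rewrite !big_ord_recl big_ord0 addr0 addrA.
exists (fun i => [:: u; v; w]`_i).
by rewrite !big_ord_recl big_ord0 addr0 addrA.
Qed.

Lemma mem_ideal_add1 I p a :
  reflect (exists c, a - c * p \in I) (a \in ideal_add I (ideal_gen [:: p])).
Proof.
apply: (iffP (asboolP _)) => [[b [_ [bI /mem_gen1[c ->] ->]]]|[c aI]].
  by exists c; rewrite addrK.
exists (a - c * p), (c * p); split; rewrite ?subrK //.
by apply/mem_gen1; exists c.
Qed.

Lemma ideal_add1_mul I p a b :
  a \in ideal_add I (ideal_gen [:: p]) -> b * p \in I -> a * b \in I.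
Proof.
move=> /mem_ideal_add1[c ac] bp; rewrite -(subrK (c * p) a) mulrDl.
by apply: idealD; [rewrite mulrC | rewrite -mulrA [p * b]mulrC]; exact: idealM.
Qed.

Lemma ideal_exp_gen2 (p q : A) (d : nat) I :
  (forall i, (i <= d)%N -> p ^+ i * q ^+ (d - i) \in I) ->
  {subset ideal_exp (ideal_gen [:: p; q]) d <= I}.
Proof.
(* The induction runs over predicates closed under sums and multiples rather than over ideals, so
   that it can be applied to the set of b with p * b, or q * b, in the target. *)
suff gen (P : A -> Prop) : (forall a b, P a -> P b -> P (a + b)) ->
    (forall a b, P b -> P (a * b)) ->
    (forall i, (i <= d)%N -> P (p ^+ i * q ^+ (d - i))) ->
    forall a, a \in ideal_exp (ideal_gen [:: p; q]) d -> P a.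
  by apply: gen => [a b|a b]; [exact: idealD | exact: idealM].
elim: d P {I} => [|d IHd] P PD PM Pmon a /=.
  by move=> /mem_gen1[u ->]; apply: (PM); have := Pmon 0 isT; rewrite mulr1.
have Pl (b : A) : b \in ideal_exp (ideal_gen [:: p; q]) d -> P (p * b).
  apply: (IHd (fun b => P (p * b))) => [u v|u v|i ied].
  - by rewrite mulrDr; exact: (PD).
  - by rewrite mulrCA; exact: PM.
  by have := Pmon i.+1 ied; rewrite subSS exprS mulrA.
have Pr (b : A) : b \in ideal_exp (ideal_gen [:: p; q]) d -> P (q * b).
  apply: (IHd (fun b => P (q * b))) => [u v|u v|i ied].
  - by rewrite mulrDr; exact: (PD).
  - by rewrite mulrCA; exact: PM.
  by have := Pmon i (leqW ied); rewrite subSn // exprS mulrCA.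
move=> /asboolP[l lP ->]; elim: l lP => [|c l IHl] lP.
  by rewrite big_nil -[0](mul0r (p ^+ 0 * q ^+ d.+1)); apply: (PM); exact: Pmon.
rewrite big_cons; apply: (PD); last by apply: IHl => c' c'l; apply: lP; rewrite inE c'l orbT.
have [/mem_gen2[u [v ->]] cd] := lP c (mem_head _ _).
by rewrite mulrDl -!mulrA; apply: (PD); apply: (PM); [exact: Pl | exact: Pr].
Qed.

Lemma exp_mem_ideal_exp I a (i : nat) : a \in I -> a ^+ i \in ideal_exp I i.
Proof.
move=> aI; elim: i => [|i IHi] /=; first by apply/mem_gen1; exists 1; rewrite mulr1.
apply/asboolP; exists [:: (a, a ^+ i)]; last by rewrite big_seq1 exprS.
by move=> c; rewrite inE => /eqP->.
Qed.

Lemma ideal_exp1 I : {subset ideal_exp I 1 <= I}.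
Proof.
move=> a /asboolP[l lP ->]; elim: l lP => [|c l IHl] lP; first by rewrite big_nil ideal0.
rewrite big_cons idealD //; last by apply: IHl => c' c'l; apply: lP; rewrite inE c'l orbT.
by have [cI _] := lP c (mem_head _ _); rewrite mulrC idealM.
Qed.

(** If a f lies in I, then so does c f for a representative c of a modulo J. An invertible c would
    put f itself in I, so c = 0 and a lies in J. *)
Lemma colon_eq_maximal I J f :
  (forall a, a \in J -> a * f \in I) -> f \notin I ->
  (forall a, exists2 c, a - c \in J & c = 0 \/ exists d, d * c = 1) ->
  J =i colon I f.
Proof.
move=> Jf fI repr a; apply/idP/idP => [/Jf//|af].
have [c ac [c0|[d dc]]] := repr a; first by rewrite c0 subr0 in ac.
have cf : c * f \in I by rewrite -[c](subKr a) mulrBl idealB // Jf.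
by move: fI; rewrite -[f]mul1r -dc -mulrA idealM.
Qed.

Section ColonTorsion.
Variables (e mm : ideal A) (f : A).
Hypothesis sat : forall a, (a \in saturI e mm) = (a \in ideal_add e (ideal_gen [:: f])).
Hypothesis colf : mm =i colon e f.

Let pie (a : A) : quotmod e := \pi_(quotmod e)%qT (a : A^o).
Let pim (a : A) : quotmod mm := \pi_(quotmod mm)%qT (a : A^o).

Let pie_eq a b : (pie a == pie b) = (a - b \in e).
Proof. exact: quotmod_piP. Qed.
Let pim_eq a b : (pim a == pim b) = (a - b \in mm).
Proof. exact: quotmod_piP. Qed.
Let pie_scale a b : pie (a * b) = a *: pie b.
Proof. exact: (@quotmod_pi_scale A A^o e a b). Qed.
Let pim_scale a b : pim (a * b) = a *: pim b.
Proof. exact: (@quotmod_pi_scale A A^o mm a b). Qed.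
Let pieD a b : pie (a + b) = pie a + pie b.
Proof. exact: (@quotmod_piD A A^o e a b). Qed.
Let pimD a b : pim (a + b) = pim a + pim b.
Proof. exact: (@quotmod_piD A A^o mm a b). Qed.

Lemma mem_torsion_quotmod a :
  (pie a \in torsion mm (quotmod e)) = (a \in saturI e mm).
Proof.
have pie0 : 0 = pie 0 by rewrite -[in RHS](mul0r 0) pie_scale scale0r.
apply/asboolP/asboolP => -[i i0 iP]; exists i => //.
  apply/asboolP => b /iP /eqP.
  by rewrite -pie_scale pie0 pie_eq subr0 mulrC.
move=> b bi; apply/eqP; rewrite -pie_scale pie0 pie_eq subr0 mulrC.
by move/asboolP: iP; apply.
Qed.

(** By [sat] the torsion of A/e is (e + (f))/e, the cyclic module generated by the class of f, and
    by [colf] the annihilator of this class is [mm]. The isomorphism sends the class of c f to the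
    class of c. *)
Lemma torsion_quotmod_iso :
  exists phi : {linear H0 mm (quotmod e) -> quotmod mm}, bijective phi.
Proof.
have genf (z : H0 mm (quotmod e)) : exists c, val z == pie (c * f).
  have := valP z; rewrite -[val z]reprK -[X in X \in _]/(pie _) mem_torsion_quotmod sat.
  by move=> /mem_ideal_add1[c ce]; exists c; rewrite -[X in X == _]/(pie _) pie_eq.
pose c z := xchoose (genf z).
have cP z : val z = pie (c z * f) by apply/eqP; exact: xchooseP (genf z).
(* The coefficient [c z] is an arbitrary choice, but its class modulo [mm] is determined, which
   makes the map linear. *)
have uniq z a : val z = pie (a * f) -> pim (c z) = pim a.
  move=> za; apply/eqP; rewrite pim_eq colf /colon unfold_in mulrBl -pie_eq.
  by rewrite -cP za.
pose phi z := pim (c z).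
have phi_lin : linear phi.
  move=> a u v; rewrite /phi -pim_scale -pimD; apply: uniq.
  by rewrite mulrDl -mulrA pieD pie_scale -!cP.
pose phiL : {linear H0 mm (quotmod e) -> quotmod mm} :=
  HB.pack phi (GRing.isLinear.Build _ _ _ _ phi phi_lin).
exists phiL.
have tors a : pie (a * f) \in torsion mm (quotmod e).
  rewrite mem_torsion_quotmod sat; apply/mem_ideal_add1; exists a.
  by rewrite subrr ideal0.
exists (fun z => SubMod (tors (repr z))) => [z|z].
  apply: val_inj; rewrite /= [RHS]cP; apply/eqP; rewrite pie_eq -mulrBl.
  have : repr (phi z) - c z \in colon e f by rewrite -colf -pim_eq /pim reprK.
  by [].
by transitivity (pim (repr z)); [exact: uniq | exact: reprK].
Qed.

End ColonTorsion.
End Ideals.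

(** * Geometric sums in t = 1 - s *)

Section GeometricSums.
Variable R : comNzRingType.
Implicit Type t : R.

(** For t = 1 - s these are the coefficients of x^(r+2) y^(n-r-1) with respect to E modulo e
    ([monomial_mod_e]), and [evengeo] gives tau. *)
Definition altgeo t r := \sum_(i < r.+1) (- t) ^+ i.
Definition evengeo t m := \sum_(q < m) t ^+ (2 * q).

Lemma altgeoS t r : altgeo t r.+1 = altgeo t r + (- t) ^+ r.+1.
Proof. by rewrite /altgeo big_ord_recr. Qed.

Lemma evengeoS t m : evengeo t m.+1 = evengeo t m + t ^+ (2 * m).
Proof. by rewrite /evengeo big_ord_recr. Qed.

(** With t = 1 - s this is the recurrence that [monomial_rec] imposes on monomials modulo g. *)
Lemma altgeo_rec t r :
  altgeo t r.+2 = (1 - t) * altgeo t r.+1 + t * altgeo t r.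
Proof. by rewrite !altgeoS [_ ^+ r.+2]exprS; ring. Qed.

Lemma exprNdouble t q : (- t) ^+ (2 * q) = t ^+ (2 * q).
Proof. by rewrite !exprM sqrrN. Qed.

(** Consecutive terms pair up as t^(2q) - t^(2q+1) = (1 - t) t^(2q). *)
Lemma altgeo_odd t m : altgeo t (2 * m).+1 = (1 - t) * evengeo t m.+1.
Proof.
elim: m => [|m IHm].
  by rewrite muln0 altgeoS /altgeo /evengeo !big_ord1 muln0 !expr0 expr1; ring.
rewrite [evengeo t m.+2]evengeoS -exprNdouble mulnS !addSn add0n 2!altgeoS IHm mulrDr.
rewrite -addrA; congr (_ + _).
by rewrite [(- t) ^+ _.+3]exprS; ring.
Qed.

Lemma sum_altgeo t m :
  \sum_(r < (2 * m).+1) (-1) ^+ r * altgeo t r = evengeo t m.+1.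
Proof.
elim: m => [|m IHm].
  by rewrite /evengeo !big_ord1 /altgeo big_ord1; ring.
rewrite [evengeo t m.+2]evengeoS -exprNdouble mulnS !addSn add0n 2!big_ord_recr /= IHm.
rewrite -addrA; congr (_ + _); rewrite !altgeoS !exprS !exprM sqrrN !expr1n.
ring.
Qed.

Lemma evengeo_telescope t m : (1 - t ^+ 2) * evengeo t m = 1 - t ^+ (2 * m).
Proof.
elim: m => [|m IHm]; first by rewrite /evengeo big_ord0 muln0 expr0; ring.
by rewrite evengeoS mulrDr IHm mulnS exprD; ring.
Qed.

Lemma geo_evengeo t m :
  t + \sum_(i < (2 * m).+1) t ^+ i.+2 = t * (1 + t) * evengeo t m.+1.
Proof.
elim: m => [|m IHm].
  by rewrite muln0 evengeoS /evengeo big_ord0 big_ord1 muln0 expr0; ring.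
rewrite evengeoS mulrDr -IHm mulnS !addSn add0n 2!big_ord_recr /= !exprS.
ring.
Qed.

(** This is the value of f at (-t, 1). Since n + 1 is even all signs cancel, leaving t^2 + ... +
    t^(n-1). *)
Lemma alternating_form t m :
  \sum_(2 <= j < (2 * m.+1).+1) (-1) ^+ j * (- t) ^+ ((2 * m.+1).+1 + 1 - j) =
  t * (1 + t) * evengeo t m.+1 - t.
Proof.
rewrite -geo_evengeo [RHS]addrAC subrr add0r.
rewrite big_nat_rev -{1}[2%N]add0n big_addn big_mkord.
have -> : ((2 * m.+1).+1 - 2 = (2 * m).+1)%N by lia.
apply: eq_bigr => -[r /= rm] _.
have -> : ((2 * m.+1).+1 + 1 - (2 + (2 * m.+1).+1 - (r + 2).+1) = r.+2)%N by lia.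
rewrite [(- t) ^+ _]exprNn mulrA -exprD -signr_odd.
by rewrite (_ : odd _ = false) ?mul1r //; lia.
Qed.

End GeometricSums.

(** * Reduction of monomials of degree at least n + 1 modulo e *)

Section Relations.
Variables (A : comNzRingType) (s x y : A) (n : nat).

Let g : A := x * y * (x - y) * (x + y - s * y).
Let e : ideal A := ideal_gen [:: x ^+ n; y ^+ n; g].
Let f : A := \sum_(2 <= j < n) (-1) ^+ j * x ^+ (n + 1 - j) * y ^+ j.

Lemma g_in_e : g \in e.
Proof. by apply/mem_gen3; exists 0, 0, 1; ring. Qed.

Lemma xn_in_e i : (n <= i)%N -> x ^+ i \in e.
Proof.
by move=> /subnK<-; apply/mem_gen3; exists (x ^+ (i - n)), 0, 0; rewrite exprD; ring.
Qed.

Lemma yn_in_e j : (n <= j)%N -> y ^+ j \in e.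
Proof.
by move=> /subnK<-; apply/mem_gen3; exists 0, (y ^+ (j - n)), 0; rewrite exprD; ring.
Qed.

Lemma monomial_rec i j : x ^+ i.+3 * y ^+ j.+1 =
  s * (x ^+ i.+2 * y ^+ j.+2) + (1 - s) * (x ^+ i.+1 * y ^+ j.+3) + x ^+ i * y ^+ j * g.
Proof. by rewrite /g !exprS; ring. Qed.

(** As long as both exponents are less than n, the degree forces both to be at least 3, and
    [monomial_rec] trades powers of x for powers of y until y^n appears. *)
Lemma high_monomial_in_e i j : (n + 2 <= i + j)%N -> x ^+ i * y ^+ j \in e.
Proof.
have [k] := ubnP i; elim: k => // k IHk in i j * => ik ijn.
have [nj|jn] := leqP n j; first by rewrite idealM // yn_in_e.
have [ni|ni] := leqP n i; first by rewrite mulrC idealM // xn_in_e.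
case: i j ik ijn jn ni => [|[|[|i]]] [|j] ik ijn jn ni; try lia.
rewrite monomial_rec; apply: idealD; last exact/idealM/g_in_e.
by apply: idealD; apply: idealM; apply: IHk; lia.
Qed.

Lemma monomial_mod_e r : (r.+1 < n)%N ->
  x ^+ r.+2 * y ^+ (n - r.+1) - altgeo (1 - s) r * (x ^+ 2 * y ^+ n.-1) \in e.
Proof.
have [k] := ubnP r; elim: k => // k IHk in r * => rk rn.
case: r rk rn => [|[|r]] rk rn.
- by rewrite /altgeo big_ord1 expr0 mul1r subn1 subrr ideal0.

(* For r = 1 the term x y^n of the recurrence already lies in e, so only s E remains. *)
- have -> : n.-1 = (n - 3).+2 by lia.
  have -> : (n - 2 = (n - 3).+1)%N by lia.
  have y3 : y ^+ (n - 3).+3 \in e by apply: yn_in_e; lia.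
  rewrite monomial_rec altgeoS /altgeo big_ord1.
  set u := _ * y ^+ (n - 3).+3; set v := _ * g; set w := _ * y ^+ _.
  have -> : s * w + (1 - s) * u + v - ((- (1 - s)) ^+ 0 + (- (1 - s)) ^+ 1) * w =
    (1 - s) * u + v by ring.
  by apply: idealD; [exact/idealM/idealM | exact/idealM/g_in_e].
have IH1 := IHk r.+1 ltac:(lia) ltac:(lia).
have IH0 := IHk r ltac:(lia) ltac:(lia).
move: IH1 IH0; set w := _ * y ^+ n.-1.
have -> : (n - r.+3 = (n - r.+4).+1)%N by lia.
have -> : (n - r.+2 = (n - r.+4).+2)%N by lia.
have -> : (n - r.+1 = (n - r.+4).+3)%N by lia.
rewrite (monomial_rec r.+1) altgeo_rec.
set a := _ * y ^+ _; set b := _ * y ^+ _; set c := _ * g.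
set S1 := altgeo _ r.+1; set S0 := altgeo _ r => IH1 IH0.
have -> : s * a + (1 - s) * b + c - ((1 - (1 - s)) * S1 + (1 - s) * S0) * w =
  s * (a - S1 * w) + (1 - s) * (b - S0 * w) + c by ring.
by apply: idealD; [apply: idealD; exact: idealM | exact/idealM/g_in_e].
Qed.

(** Each monomial of f is a multiple of E modulo e, and [sum_altgeo] adds up the coefficients. Here
    [m.+1] is the integer m of the theorem. *)
Lemma f_mod_e m : n = (2 * m.+1).+1 ->
  f - evengeo (1 - s) m.+1 * (x ^+ 2 * y ^+ n.-1) \in e.
Proof.
move=> nE; rewrite -sum_altgeo mulr_suml.
(* Substitute j = n - 1 - r; since n is odd, the sign becomes (-1)^r. *)
have -> : f = \sum_(r < (2 * m).+1) (-1) ^+ r * (x ^+ r.+2 * y ^+ (n - r.+1)).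
  rewrite /f big_nat_rev -{1}[2%N]add0n big_addn big_mkord.
  have -> : (n - 2 = (2 * m).+1)%N by lia.
  apply: eq_bigr => -[r /= rm] _.
  have -> : (n + 1 - (2 + n - (r + 2).+1) = r.+2)%N by lia.
  have -> : (2 + n - (r + 2).+1 = n - r.+1)%N by lia.
  rewrite [RHS]mulrA -(signr_odd _ r) -(signr_odd _ (n - _)).
  by have -> : odd (n - r.+1) = odd r by lia.
rewrite -sumrB; apply: (@rpred_sum A^o e) => -[r /= rm] _.
rewrite -[X in _ - X]mulrA -mulrBr; apply/idealM/monomial_mod_e; lia.
Qed.

(** The monomial x^n y lies in e, and [monomial_mod_e] with [altgeo_odd] gives it the coefficient s
    tau. *)
Lemma s_evengeo_in_e m : n = (2 * m.+1).+1 ->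
  s * evengeo (1 - s) m.+1 * (x ^+ 2 * y ^+ n.-1) \in e.
Proof.
move=> nE; have := @monomial_mod_e (2 * m).+1 ltac:(lia).
have -> : (n - (2 * m).+2 = 1)%N by lia.
have -> : (2 * m).+3 = n by lia.
rewrite altgeo_odd subKr => /ideal_eqmod <-.
by rewrite mulrC idealM // xn_in_e.
Qed.

Lemma sf_in_e m : n = (2 * m.+1).+1 -> s * f \in e.
Proof.
move=> nE; have := idealM s (f_mod_e nE).
by rewrite mulrBr [s * (_ * _)]mulrA => /ideal_eqmod->; exact: (s_evengeo_in_e nE).
Qed.

Lemma linear_f_in_e u v : (u * x + v * y) * f \in e.
Proof.
rewrite mulr_sumr big_nat; apply: (@rpred_sum A^o e) => j /andP[j2 jn].
rewrite -[_ * x ^+ _ * _]mulrA mulrCA; apply: idealM.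
have -> : (u * x + v * y) * (x ^+ (n + 1 - j) * y ^+ j) =
    u * (x ^+ (n + 1 - j).+1 * y ^+ j) + v * (x ^+ (n + 1 - j) * y ^+ j.+1).
  by rewrite !exprS; ring.
by apply: idealD; apply: idealM; apply: high_monomial_in_e; lia.
Qed.

End Relations.

(** * Division by g, with [B] in the role of k[s] and [sg] in that of s *)

Section NormalForm.
Variables (B A : comNzRingType) (io : {rmorphism B -> A}) (sg : B) (x y : A).

Definition ev (v : A) (P : {poly B}) : A := (map_poly io P).[v].

Lemma evD v (P Q : {poly B}) : ev v (P + Q) = ev v P + ev v Q.
Proof. by rewrite /ev rmorphD hornerD. Qed.

Lemma evMC v c (P : {poly B}) : ev v (c%:P * P) = io c * ev v P.
Proof. by rewrite /ev rmorphM /= map_polyC hornerM hornerC. Qed.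

Lemma evMX v (P : {poly B}) : ev v ('X * P) = v * ev v P.
Proof. by rewrite /ev rmorphM /= map_polyX hornerM hornerX. Qed.

Lemma ev0 v : ev v 0 = 0.
Proof. by rewrite /ev rmorph0 horner0. Qed.

Lemma evXn v j : ev v 'X^j = v ^+ j.
Proof. by rewrite /ev map_polyXn hornerXn. Qed.

Lemma ev_sum v (P : {poly B}) : ev v P = \sum_(i < size P) io P`_i * v ^+ i.
Proof.
rewrite /ev (@horner_coef_wide _ (size P)) ?size_poly //.
by apply: eq_bigr => i _; rewrite coef_map.
Qed.

Lemma ev_in_ideal (I : ideal A) u v (P : {poly B}) :
  (forall i, u * (io P`_i * v ^+ i) \in I) -> u * ev v P \in I.
Proof. by move=> uI; rewrite ev_sum mulr_sumr; apply: (@rpred_sum A^o I). Qed.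

(** The monomials x^i, y^(j+1), x y^(j+1), x^2 y^(j+1) are exactly those not divisible by x^3 y. *)
Definition nf (P Q0 Q1 Q2 : {poly B}) : A :=
  ev x P + y * ev y Q0 + x * y * ev y Q1 + x ^+ 2 * y * ev y Q2.

Definition has_nf (a : A) := exists w P Q0 Q1 Q2,
  a = nf P Q0 Q1 Q2 + w * (x * y * (x - y) * (x + y - io sg * y)).

Lemma has_nfD a b : has_nf a -> has_nf b -> has_nf (a + b).
Proof.
move=> [w [P [Q0 [Q1 [Q2 ->]]]]] [w' [P' [Q0' [Q1' [Q2' ->]]]]].
exists (w + w'), (P + P'), (Q0 + Q0'), (Q1 + Q1'), (Q2 + Q2').
by rewrite /nf !evD; ring.
Qed.

Lemma has_nf_scale c a : has_nf a -> has_nf (io c * a).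
Proof.
move=> [w [P [Q0 [Q1 [Q2 ->]]]]].
exists (io c * w), (c%:P * P), (c%:P * Q0), (c%:P * Q1), (c%:P * Q2).
by rewrite /nf !evMC; ring.
Qed.

(* The quartic has leading monomial [x ^+ 3 * y], with coefficient 1, so that it can
   be divided out. *)
Lemma has_nf_mulx a : has_nf a -> has_nf (x * a).
Proof.
move=> [w [P [Q0 [Q1 [Q2 ->]]]]].
(* Q0 and Q1 move up one place, and the overflow x^3 y Q2(y) is reduced by x^3 y = s x^2 y^2 + (1 -
   s) x y^3 + g. *)
exists (x * w + ev y Q2), ('X * P), 0,
  (Q0 + (1 - sg)%:P * ('X * ('X * Q2))), (Q1 + sg%:P * ('X * Q2)).
by rewrite /nf !(evD, evMC, evMX, ev0, rmorphB, rmorph1); ring.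
Qed.

Lemma has_nf_monomial c i j : has_nf (io c * (x ^+ i * y ^+ j)).
Proof.
apply: has_nf_scale; elim: i => [|i IHi]; last first.
  by rewrite exprS -mulrA; exact: has_nf_mulx.
rewrite mul1r; case: j => [|j].
  by exists 0, 'X^0, 0, 0, 0; rewrite /nf !ev0 evXn !expr0; ring.
by exists 0, 0, 'X^j, 0, 0; rewrite /nf !ev0 evXn exprS; ring.
Qed.

End NormalForm.

Lemma coef_comp_scaleX (B : comNzRingType) (c : B) (P : {poly B}) d :
  (P \Po (c%:P * 'X))`_d = P`_d * c ^+ d.
Proof.
elim/poly_ind: P d => [|P b IHP] d; first by rewrite comp_poly0 !coef0 mul0r.
rewrite comp_polyD comp_polyM comp_polyX comp_polyC mulrA !coefD !coefMX.
case: d => [|d] /=; first by rewrite !coefC mulr1.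
rewrite /= [_ * c%:P]mulrC coefCM IHP !coefC /= !addr0 exprS; ring.
Qed.

(** * The ring k[s,x,y] over k[s] and restriction to lines *)

Section Evaluation.
Variable k : fieldType.
Local Notation A := ({mpoly k[3]} : comNzRingType).
Local Notation B := {poly k}.
Local Notation s := ('X_(@Ordinal 3 0 isT) : A).
Local Notation x := ('X_(@Ordinal 3 1 isT) : A).
Local Notation y := ('X_(@Ordinal 3 2 isT) : A).

Definition scal : B -> A := horner_eval s \o map_poly (@mpolyC 3 k).
HB.instance Definition _ := GRing.RMorphism.on scal.

Lemma scalX : scal 'X = s.
Proof. by rewrite /scal /= map_polyX /horner_eval hornerX. Qed.

Lemma scalC c : scal c%:P = c%:MP.
Proof. by rewrite /scal /= map_polyC /horner_eval hornerC. Qed.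

(** Moving the powers of s into the coefficients gives induction on polynomials in x, y over
    k[s]. *)
Lemma mpoly3_span (P : A -> Prop) :
  (forall c i j, P (scal c * (x ^+ i * y ^+ j))) ->
  (forall a b, P a -> P b -> P (a + b)) -> forall a, P a.
Proof.
move=> Pm PD; apply: mpolyind => [|c m p _ _ Pp].
  by have := Pm 0 0 0; rewrite rmorph0 mul0r.
apply: PD => //; have := Pm (c%:P * 'X^(m (@Ordinal 3 0 isT)))
  (m (@Ordinal 3 1 isT)) (m (@Ordinal 3 2 isT)).
rewrite rmorphM rmorphXn /= scalX scalC -mul_mpolyC (mpolyXE_id _ m).
rewrite !big_ord_recl big_ord0 mulr1 -!mulrA.
have -> : lift ord0 (lift ord0 ord0) = @Ordinal 3 2 isT by apply: val_inj.
have -> : lift ord0 ord0 = @Ordinal 3 1 isT by apply: val_inj.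
by have -> : ord0 = @Ordinal 3 0 isT by apply: val_inj.
Qed.

Lemma mpoly3_mod_origin (a : A) : exists c : k, a - c%:MP \in (ideal_gen [:: s; x; y] : ideal A).
Proof.
elim/mpoly3_span: a => [c i j|a b [c ac] [d bd]]; last first.
  by exists (c + d); rewrite rmorphD opprD addrACA idealD.
case: i j => [|i] [|j].
- elim/poly_ind: c => [|c a _]; first by exists 0; rewrite !rmorph0 mul0r subrr ideal0.
  exists a; apply/mem_gen3; exists (scal c), 0, 0.
  by rewrite rmorphD rmorphM /= scalX scalC; ring.
- by exists 0; apply/mem_gen3; exists 0, 0, (scal c * y ^+ j); rewrite rmorph0 exprS; ring.
- by exists 0; apply/mem_gen3; exists 0, (scal c * x ^+ i), 0; rewrite rmorph0 exprS; ring.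
- exists 0; apply/mem_gen3; exists 0, (scal c * x ^+ i * y ^+ j.+1), 0.
  by rewrite rmorph0 exprS; ring.
Qed.

Section Phi.
Variables al be : B.

(** Restriction to the line through ([al], [be]) over k[s]: the coefficient of degree d is the value
    at this point of the part homogeneous of degree d in x, y. *)
Definition phi : A -> {poly B} :=
  mmap (polyC \o polyC) (fun i : 'I_3 => [:: 'X%:P; al%:P * 'X; be%:P * 'X]`_i).
HB.instance Definition _ := GRing.RMorphism.on phi.

Lemma phi_s : phi s = 'X%:P. Proof. by rewrite /phi mmapX mmap1U. Qed.
Lemma phi_x : phi x = al%:P * 'X. Proof. by rewrite /phi mmapX mmap1U. Qed.
Lemma phi_y : phi y = be%:P * 'X. Proof. by rewrite /phi mmapX mmap1U. Qed.

Lemma phi_scal c : phi (scal c) = c%:P.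
Proof.
elim/poly_ind: c => [|c a IHc]; first by rewrite !rmorph0.
rewrite !rmorphD !rmorphM /= IHc scalX scalC phi_s; congr (_ + _).
by rewrite /phi mmapC.
Qed.

Lemma coef_phi_monomial c i j d :
  (phi (scal c * (x ^+ i * y ^+ j)))`_d = c * (al ^+ i * be ^+ j) *+ (d == (i + j)%N).
Proof.
rewrite !rmorphM !rmorphXn /= phi_scal phi_x phi_y !exprMn mulrACA -exprD.
by rewrite -!polyC_exp -!polyCM !coefCM coefXn mulrA mulr_natr.
Qed.

Lemma coef_phi_ev v c P d : phi v = c%:P * 'X ->
  (phi (ev scal v P))`_d = P`_d * c ^+ d.
Proof.
move=> vE; rewrite -coef_comp_scaleX -vE; congr (_`_d).
rewrite /ev /comp_poly -horner_map /= -map_poly_comp.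
by rewrite (eq_map_poly (g := polyC)) // => b; exact: phi_scal.
Qed.

End Phi.
End Evaluation.

(** * Detecting membership in e and h on the four lines of g *)

Section Detection.
Variables (k : fieldType) (m n : nat).
Hypothesis nE : n = (2 * m.+1).+1.
Local Notation A := ({mpoly k[3]} : comNzRingType).
Local Notation B := {poly k}.
Local Notation s := ('X_(@Ordinal 3 0 isT) : A).
Local Notation x := ('X_(@Ordinal 3 1 isT) : A).
Local Notation y := ('X_(@Ordinal 3 2 isT) : A).
Local Notation scal := (@scal k).
Let g : A := x * y * (x - y) * (x + y - s * y).
Let e : ideal A := ideal_gen [:: x ^+ n; y ^+ n; g].
Let f : A := \sum_(2 <= j < n) (-1) ^+ j * x ^+ (n + 1 - j) * y ^+ j.
Let h : ideal A := ideal_add e (ideal_gen [:: f]).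
Let t : B := 1 - 'X.
Let tau : B := evengeo t m.+1.

Let form (al be : B) : B :=
  \sum_(2 <= j < n) (-1) ^+ j * al ^+ (n + 1 - j) * be ^+ j.

(** The same constant and linear terms in x, y serve for all lines, so that values on different
    lines can be compared. *)
Lemma jet1 (u : A) : exists u0 u1 u2 : B, forall al be,
  (phi al be u)`_0 = u0 /\ (phi al be u)`_1 = al * u1 + be * u2.
Proof.
elim/mpoly3_span: u => [c i j|a b [a0 [a1 [a2 aE]]] [b0 [b1 [b2 bE]]]].
  exists (c *+ (i + j == 0)), (c *+ ((i == 1) && (j == 0))), (c *+ ((i == 0) && (j == 1))).
  move=> al be; rewrite !coef_phi_monomial.
  by case: i j => [|[|i]] [|[|j]];
    rewrite ?addn0 ?add0n ?addSn ?addnS /= ?mulr0n ?mulr1n; split; ring.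
exists (a0 + b0), (a1 + b1), (a2 + b2) => al be.
have [pa0 pa1] := aE al be; have [pb0 pb1] := bE al be.
by rewrite raddfD !coefD pa0 pa1 pb0 pb1; split; ring.
Qed.

Let line10 : 1 * 0 * (1 - 0) * (1 + t * 0) = 0 :> B. Proof. by ring. Qed.
Let line01 : 0 * 1 * (0 - 1) * (0 + t * 1) = 0 :> B. Proof. by ring. Qed.
Let line11 : 1 * 1 * (1 - 1) * (1 + t * 1) = 0 :> B. Proof. by ring. Qed.
Let linet : - t * 1 * (- t - 1) * (- t + t * 1) = 0 :> B. Proof. by ring. Qed.

Lemma phi_g al be : al * be * (al - be) * (al + t * be) = 0 -> phi al be g = 0.
Proof.
move=> g0; rewrite /g !(rmorphM, rmorphB, rmorphD) /= phi_x phi_y phi_s.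
suff -> : al%:P * 'X * (be%:P * 'X) * (al%:P * 'X - be%:P * 'X) *
   (al%:P * 'X + be%:P * 'X - ('X : B)%:P * (be%:P * 'X)) =
   (al * be * (al - be) * (al + t * be))%:P * 'X ^+ 4.
  by rewrite g0 mul0r.
by rewrite /t !(rmorphM, rmorphB, rmorphD) /= rmorph1; ring.
Qed.

(** On a line where g vanishes everything is divisible by ['X^n], so degrees n and n + 1 involve
    only the constant and linear terms of u, v and the constant term of c. *)
Lemma phi_h al be u v w c : al * be * (al - be) * (al + t * be) = 0 ->
  phi al be (u * x ^+ n + v * y ^+ n + w * g + c * f) =
  ((al ^+ n)%:P * phi al be u + (be ^+ n)%:P * phi al be v
    + (form al be)%:P * 'X * phi al be c) * 'X^n.
Proof.
move=> /phi_g phig.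
have phif : phi al be f = (form al be)%:P * 'X * 'X^n.
  rewrite /f /form !rmorph_sum /= -mulrA -exprS mulr_suml big_nat [RHS]big_nat.
  apply: eq_bigr => j /andP[j2 jn].
  rewrite !rmorphM !rmorphXn rmorphN rmorph1 /= phi_x phi_y !exprMn.
  rewrite rmorphN rmorph1.
  have -> : 'X^(n.+1) = 'X^(n + 1 - j) * 'X^j :> {poly B} by rewrite -exprD; congr (_ ^+ _); lia.
  ring.
have phiM a b : phi al be (a * b) = phi al be a * phi al be b by exact: rmorphM.
have phiX a i : phi al be (a ^+ i) = phi al be a ^+ i by exact: rmorphXn.
have phiD a b : phi al be (a + b) = phi al be a + phi al be b by exact: rmorphD.
have phiu : phi al be (u * x ^+ n) = (al ^+ n)%:P * phi al be u * 'X^n.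
  by rewrite phiM phiX phi_x exprMn -polyC_exp mulrCA mulrA.
have phiv : phi al be (v * y ^+ n) = (be ^+ n)%:P * phi al be v * 'X^n.
  by rewrite phiM phiX phi_y exprMn -polyC_exp mulrCA mulrA.
have phiw : phi al be (w * g) = 0 by rewrite phiM phig mulr0.
have phic : phi al be (c * f) = (form al be)%:P * 'X * phi al be c * 'X^n.
  by rewrite phiM phif mulrCA mulrA [_ * phi al be c]mulrC.
have phiD4 a b a' b' :
    phi al be (a + b + a' + b') = phi al be a + phi al be b + phi al be a' + phi al be b'.
  by rewrite !phiD.
by rewrite phiD4 2!mulrDl -[X in _ = X + _]addr0; congr (_ + _ + _ + _).
Qed.

Lemma mem_h a : reflect (exists u v w c, a = u * x ^+ n + v * y ^+ n + w * g + c * f)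
  (a \in h).
Proof.
apply: (iffP (mem_ideal_add1 _ _ _)) => [[c /mem_gen3[u [v [w aE]]]]|[u [v [w [c ->]]]]].
  by exists u, v, w, c; rewrite -aE subrK.
by exists c; rewrite addrK; apply/mem_gen3; exists u, v, w.
Qed.

Lemma e_sub_h a : a \in e -> a \in h.
Proof. by move=> ae; apply/mem_ideal_add1; exists 0; rewrite ?mul0r ?subr0. Qed.

Lemma coef_phi_h_lt a al be d : a \in h -> al * be * (al - be) * (al + t * be) = 0 ->
  (d < n)%N -> (phi al be a)`_d = 0.
Proof. by move=> /mem_h[u [v [w [c ->]]]] g0 dn; rewrite phi_h // coefMXn dn. Qed.

Lemma coef_phi_h_n a : a \in h ->
  exists u v, forall al be, al * be * (al - be) * (al + t * be) = 0 ->
  (phi al be a)`_n = al ^+ n * u + be ^+ n * v.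
Proof.
move=> /mem_h[u [v [w [c ->]]]].
have [u0 [u1 [u2 uE]]] := jet1 u; have [v0 [v1 [v2 vE]]] := jet1 v.
exists u0, v0 => al be g0; rewrite phi_h // coefMXn ltnn subnn !coefD -mulrA !coefCM.
by rewrite coefXM (uE al be).1 (vE al be).1 /= mulr0 addr0.
Qed.

(* [c10], [c01], [c11], [ct] are the values of a form of degree [n.+1] at the points
   (1, 0), (0, 1), (1, 1), (-t, 1); the combination vanishes on [x ^+ n.+1] and
   [y ^+ n.+1]. *)
Let top_comb (c10 c01 c11 ct : B) : B :=
  t * (c11 - c10 - c01) + ct - c01 - t ^+ n.+1 * c10.

Definition top_form (a : A) : B := top_comb
  (phi 1 0 a)`_n.+1 (phi 0 1 a)`_n.+1 (phi 1 1 a)`_n.+1 (phi (- t) 1 a)`_n.+1.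

Lemma top_formE a c10 c01 c11 ct :
  (phi 1 0 a)`_n.+1 = c10 -> (phi 0 1 a)`_n.+1 = c01 ->
  (phi 1 1 a)`_n.+1 = c11 -> (phi (- t) 1 a)`_n.+1 = ct ->
  top_form a = t * (c11 - c10 - c01) + ct - c01 - t ^+ n.+1 * c10.
Proof. by move=> <- <- <- <-. Qed.

Lemma oppr_expn : (- t) ^+ n = - t ^+ n.
Proof. by rewrite exprNn -signr_odd (_ : odd n = true) ?mulN1r //; lia. Qed.

(** The combination also kills x y^n. What remains is u2 x^n y, with value t - t^n = t (1 + t) s
    tau, and the constant term of c times f, with value t (1 + t) tau; hence z = u2. *)
Lemma top_form_h u v w c : exists z,
  top_form (u * x ^+ n + v * y ^+ n + w * g + c * f) =
  t * (1 + t) * tau * ('X * z + (phi 1 1 c)`_0).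
Proof.
have [u0 [u1 [u2 uE]]] := jet1 u; have [v0 [v1 [v2 vE]]] := jet1 v.
have [c0 [c1 [c2 cE]]] := jet1 c.
have coef_top al be : al * be * (al - be) * (al + t * be) = 0 ->
    (phi al be (u * x ^+ n + v * y ^+ n + w * g + c * f))`_n.+1 =
    al ^+ n * (al * u1 + be * u2) + be ^+ n * (al * v1 + be * v2) + form al be * c0.
  move=> g0; rewrite phi_h // coefMXn ltnNge leqnSn subSnn /= !coefD -!mulrA !coefCM.
  by rewrite coefXM (uE al be).2 (vE al be).2 (cE al be).1.
have form_t r : form (- r) 1 = r * (1 + r) * evengeo r m.+1 - r.
  by rewrite -alternating_form -nE; apply: eq_bigr => j _; rewrite expr1n mulr1.
have form10 : form 1 0 = 0.
  rewrite /form big_nat big1 // => j /andP[j2 _].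
  by rewrite expr0n; case: j j2 => // j _; rewrite mulr0.
have form01 : form 0 1 = 0.
  rewrite /form big_nat big1 // => j /andP[_ jn].
  by rewrite expr0n -[(n + 1 - j)%N]prednK ?mulr0 ?mul0r //; lia.
(* The point (1, 1) is the case r = -1, where the factor 1 + r vanishes. *)
have form11 : form 1 1 = 1 by rewrite -[X in form X](opprK 1) form_t; ring.
have tel : t * t ^+ (2 * m.+1) = t - t * (1 + t) * tau * 'X.
  have -> : t ^+ (2 * m.+1) = 1 - (1 - t ^+ 2) * tau by rewrite evengeo_telescope; ring.
  by rewrite /t; ring.
exists u2; rewrite (cE 1 1).1.
rewrite (top_formE (coef_top _ _ line10) (coef_top _ _ line01) (coef_top _ _ line11)
  (coef_top _ _ linet)).
have n0 : (n == 0)%N = false by lia.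
rewrite form_t form10 form01 form11 oppr_expn -/tau !expr1n !expr0n n0 /= [t ^+ n.+1]exprS.
rewrite nE exprS tel. ring.
Qed.

Lemma t_neq0 : t * (1 + t) != 0.
Proof.
rewrite mulf_neq0 //; apply/eqP => /polyP t0.
  by have := t0 0; rewrite /t !(coefB, coefD, coefC, coefX) /= subr0 => /eqP; rewrite oner_eq0.
(* For 1 + t = 2 - s the coefficient of s is compared, since the constant term is zero in
   characteristic 2. *)
have := t0 1; rewrite /t !(coefB, coefD, coefC, coefX) /= add0r sub0r => /eqP.
by rewrite oppr_eq0 oner_eq0.
Qed.

Hypothesis char_m : m.+1%:R != 0 :> k.

Lemma tau0 : tau.[0] = m.+1%:R.
Proof.
rewrite /tau /evengeo horner_sum (eq_bigr (fun=> 1)) ?sumr_const ?card_ord // => q _.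
by rewrite /t !hornerE subr0 expr1n.
Qed.

Lemma tau_neq0 : tau != 0.
Proof. by apply: contraNneq char_m => t0; rewrite -tau0 t0 horner0. Qed.

(** Compute [top_form] of f twice: as 1 * f, and as an element of e. Cancelling t (1 + t) tau leaves
    s z + 1 = s z', which fails at s = 0. *)
Lemma f_notin_e : f \notin e.
Proof.
apply/negP => /mem_gen3[u [v [w fE]]].
have [z] := top_form_h 0 0 0 1; have [z'] := top_form_h u v w 0.
rewrite mul0r addr0 -fE !mul0r !add0r mul1r => -> /esym/(mulfI (mulf_neq0 t_neq0 tau_neq0)).
move/(congr1 (horner^~ 0)).
rewrite !rmorph0 rmorph1 !coef0 coef1 !hornerE /= => /eqP.
by rewrite oner_eq0.
Qed.

(** The factors ['X], ['X^2], ['X^3] index the coefficients of Q0, Q1, Q2 by the total degree in x,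
    y of their terms. *)
Lemma coef_phi_nf al P Q0 Q1 Q2 w d :
  al * 1 * (al - 1) * (al + t * 1) = 0 ->
  (phi al 1 (nf scal x y P Q0 Q1 Q2 + w * (x * y * (x - y) * (x + y - scal 'X * y))))`_d =
  al ^+ d * P`_d + ('X * Q0)`_d + al * ('X^2 * Q1)`_d + al ^+ 2 * ('X^3 * Q2)`_d.
Proof.
move=> g0; rewrite scalX.
have phiM a b : phi al 1 (a * b) = phi al 1 a * phi al 1 b by exact: rmorphM.
have phig : phi al 1 (x * y * (x - y) * (x + y - s * y)) = 0.
  exact: phi_g.
have phiy : phi al 1 y = 'X by rewrite phi_y mul1r.
have evy (Q : {poly B}) : phi al 1 (ev scal y Q) = Q.
  by apply/polyP => i; rewrite (@coef_phi_ev _ _ _ _ 1) ?expr1n ?mulr1 // phi_y.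
rewrite rmorphD /= (phiM w) phig mulr0 addr0 /nf !rmorphD /= !coefD (coef_phi_ev _ _ (phi_x _ _)).
rewrite 3!(phiM _ (ev _ _ _)) !evy (phiM (x ^+ 2)) (phiM x y) rmorphXn /= phi_x phiy.
congr (_ + _ + _ + _); first exact: mulrC.
  by rewrite -!mulrA coefCM.
by rewrite exprMn -polyC_exp -!mulrA coefCM [RHS]mulrA.
Qed.

Lemma coef_phi_nf0 P Q0 Q1 Q2 w d :
  (phi 1 0 (nf scal x y P Q0 Q1 Q2 + w * (x * y * (x - y) * (x + y - scal 'X * y))))`_d =
  P`_d.
Proof.
have phiM a b : phi 1 0 (a * b) = phi 1 0 a * phi 1 0 b by exact: rmorphM.
have phiy : phi 1 0 y = 0 by rewrite phi_y mul0r.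
rewrite /nf !rmorphD /= !phiM phiy !(mulr0, mul0r, addr0).
by rewrite (coef_phi_ev _ _ (phi_x _ _)) expr1n mulr1.
Qed.

Lemma scal_tau : scal tau = evengeo (1 - s) m.+1.
Proof.
rewrite /tau /evengeo rmorph_sum /=; apply: eq_bigr => q _.
by rewrite rmorphXn /= rmorphB rmorph1 /= scalX.
Qed.

Lemma f_in_h : f \in h.
Proof. by apply/mem_ideal_add1; exists 1; rewrite ?mul1r ?subrr ?ideal0. Qed.

(** The restrictions of s a, divided by s, constrain the normal form of a: every term without a
    factor x^n or y^n vanishes, except a multiple of E whose coefficient is divisible by tau, and
    tau E is f modulo e. *)
Lemma saturated_h a : s * a \in h -> a \in h.
Proof.
have [w [P [Q0 [Q1 [Q2 aE]]]]] : has_nf scal 'X x y a.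
  by elim/mpoly3_span: a => [c i j|a b]; [exact: has_nf_monomial | exact: has_nfD].
move=> sah.
have coef_s al be d : (phi al be (s * a))`_d = 'X * (phi al be a)`_d.
  by rewrite rmorphM /= phi_s coefCM.
have P_d d : (phi 1 0 a)`_d = P`_d by rewrite aE coef_phi_nf0.
have nf_d al d : al * 1 * (al - 1) * (al + t * 1) = 0 -> (phi al 1 a)`_d =
  al ^+ d * P`_d + ('X * Q0)`_d + al * ('X^2 * Q1)`_d + al ^+ 2 * ('X^3 * Q2)`_d.
  by move=> g0; rewrite aE coef_phi_nf.
have X0 (b : B) : 'X * b = 0 -> b = 0.
  by move/eqP; rewrite mulf_eq0 polyX_eq0 => /eqP.
have Plow d : (d < n)%N -> P`_d = 0.
  by move=> dn; apply: X0; rewrite -P_d -coef_s (coef_phi_h_lt sah line10).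
have Q0low d : (0 < d < n)%N -> ('X * Q0)`_d = 0.
  move=> /andP[d0 dn]; apply: X0.
  have := coef_phi_h_lt sah line01 dn.
  by rewrite coef_s (nf_d _ _ line01) Plow // => E; rewrite -[RHS]E; ring.
have Qlow d : (0 < d <= n)%N -> ('X^2 * Q1)`_d = 0 /\ ('X^3 * Q2)`_d = 0.
  move=> /andP[d0 dn].
  (* The values at (1, 1) and (-t, 1) give a linear system for the coefficients of Q1 and Q2, with
     determinant t (1 + t). *)
  suff [E1 E2] : 'X * (('X^2 * Q1)`_d + ('X^3 * Q2)`_d) = 0 /\
      'X * (- t * ('X^2 * Q1)`_d + t ^+ 2 * ('X^3 * Q2)`_d) = 0.
    have Q2d : ('X^3 * Q2)`_d = 0.
      apply: X0; apply: (mulfI t_neq0).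
      have <- : t * 0 + 0 = t * (1 + t) * 0 by ring.
      by rewrite -[X in _ = t * X + _]E1 -[X in _ = _ + X]E2; ring.
    by move: E1; rewrite Q2d addr0 => /X0.
  (* In degree n the restrictions of s a are those of u x^n + v y^n, and the points (1, 0), (0, 1)
     identify u and v with the contributions of P and Q0, which then drop out; for d < n both are
     zero. *)
  have [u [v uv]] : exists u v, forall al be, al * be * (al - be) * (al + t * be) = 0 ->
      (phi al be (s * a))`_d = al ^+ d * u + be ^+ d * v.
    move: dn; rewrite leq_eqVlt => /orP[/eqP->|dn]; first exact: coef_phi_h_n.
    by exists 0, 0 => al be g0; rewrite (coef_phi_h_lt sah g0 dn); ring.
  have E1 := uv _ _ line10; rewrite coef_s P_d in E1.
  have E2 := uv _ _ line01; rewrite coef_s (nf_d _ _ line01) in E2.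
  have E3 := uv _ _ line11; rewrite coef_s (nf_d _ _ line11) in E3.
  have E4 := uv _ _ linet; rewrite coef_s (nf_d _ _ linet) in E4.
  move: E4 E3 E2 E1.
  rewrite !expr1n !expr0n (gtn_eqF d0) /= => E4 E3 E2 E1.
  have Eu : u = 'X * P`_d by rewrite E1; ring.
  have Ev : v = 'X * ('X * Q0)`_d by transitivity (0 * u + 1 * v); [ring | rewrite -E2; ring].
  move: E3 E4; rewrite Eu Ev => E3 E4; split.
    by move/eqP: E3; rewrite -subr_eq0 => /eqP E; rewrite -[RHS]E; ring.
  by move/eqP: E4; rewrite -subr_eq0 => /eqP E; rewrite -[RHS]E; ring.
have [z Q2top] : exists z, ('X^3 * Q2)`_n.+1 = z * tau.
  have [u [v [w' [c saE]]]] := elimT (mem_h _) sah.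
  have [z] := top_form_h u v w' c; rewrite -saE.
  have c10 := coef_s 1 0 n.+1; rewrite P_d in c10.
  have c01 := coef_s 0 1 n.+1; rewrite (nf_d _ _ line01) in c01.
  have c11 := coef_s 1 1 n.+1; rewrite (nf_d _ _ line11) in c11.
  have ct := coef_s (- t) 1 n.+1; rewrite (nf_d _ _ linet) in ct.
  rewrite (top_formE c10 c01 c11 ct).
  have neven : (- t) ^+ n.+1 = t ^+ n.+1 by rewrite exprS oppr_expn mulrNN -exprS.
  rewrite neven !expr1n !expr0n /=; set b := (_ + (phi 1 1 c)`_0) => E.
  (* On a normal form [top_form] sees only the term in x^2 y^(n-1), with value t (1 + t). *)
  have {E} : 'X * ('X^3 * Q2)`_n.+1 = tau * b.
    by apply: (mulfI t_neq0); rewrite [RHS]mulrA -E; ring.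
  move=> E; have : tau %| 'X * ('X^3 * Q2)`_n.+1 by rewrite E dvdp_mulr.
  (* Since tau is nonzero at s = 0, it is coprime to s. *)
  rewrite Gauss_dvdpr; last first.
    by rewrite coprimepX /root tau0.
  by move/dvdpP=> [z' ->]; exists z'.
have yh i b : (n <= i)%N -> b * y ^+ i \in h.
  by move=> ni; apply/idealM/e_sub_h/yn_in_e.
rewrite aE /= scalX; apply: idealD; last exact/idealM/e_sub_h/g_in_e.
apply: idealD; last first.
  apply: ev_in_ideal => i; have -> : x ^+ 2 * y * (scal Q2`_i * y ^+ i) =
    scal Q2`_i * x ^+ 2 * y ^+ i.+1 by rewrite [y ^+ i.+1]exprS; ring.
  have Q2i : Q2`_i = ('X^3 * Q2)`_(i + 3) by rewrite coefXnM ltnNge leq_addl addnK.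
  have [ni|ni] := leqP n i.+1; first exact: yh.
  have [i3|i3] := leqP (i + 3) n.
    by rewrite Q2i (Qlow _ _).2 ?i3 ?addn3 // rmorph0 !mul0r ideal0.
  (* The only surviving term is the multiple of E. *)
  have i3n : (i + 3)%N = n.+1 by lia.
  have -> : i.+1 = n.-1 by lia.
  rewrite Q2i i3n Q2top rmorphM /= -[_ * x ^+ 2 * _]mulrA -[_ * scal tau * _]mulrA.
  rewrite scal_tau; apply: idealM.
  by rewrite -(ideal_eqmod (e_sub_h (f_mod_e s x y nE))) f_in_h.
apply: idealD; last first.
  apply: ev_in_ideal => i; have -> : x * y * (scal Q1`_i * y ^+ i) =
    scal Q1`_i * x * y ^+ i.+1 by rewrite exprS; ring.
  have Q1i : Q1`_i = ('X^2 * Q1)`_(i + 2) by rewrite coefXnM ltnNge leq_addl addnK.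
  have [ni|ni] := leqP n i.+1; first exact: yh.
  by rewrite Q1i (Qlow _ _).1 ?rmorph0 ?mul0r ?ideal0 //; lia.
apply: idealD; last first.
  apply: ev_in_ideal => i; have -> : y * (scal Q0`_i * y ^+ i) =
    scal Q0`_i * y ^+ i.+1 by rewrite exprS; ring.
  have Q0i : Q0`_i = ('X * Q0)`_(i.+1) by rewrite coefXM.
  have [ni|ni] := leqP n i.+1; first exact: yh.
  by rewrite Q0i Q0low ?rmorph0 ?mul0r ?ideal0 //; lia.
rewrite -[ev _ _ _]mul1r; apply: ev_in_ideal => i; rewrite mul1r.
have [ni|ni] := leqP n i; first exact/idealM/e_sub_h/xn_in_e.
by rewrite Plow // rmorph0 mul0r ideal0.
Qed.

End Detection.

(** * The seven assertions on e, h and the local cohomology of A/e *)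

Theorem mainTheorem1 (k : fieldType) (m : nat) (hm : (4 <= m)%N)
    (hchar : forall p : nat, p \in [pchar k] -> ~~ (p %| m)%N) :
  let n : nat := (2 * m + 1)%N in
  let A : comNzRingType := {mpoly k[3]} in
  let s : A := 'X_(@Ordinal 3 0 isT) in
  let x : A := 'X_(@Ordinal 3 1 isT) in
  let y : A := 'X_(@Ordinal 3 2 isT) in
  let mm : ideal A := ideal_gen [:: s; x; y] in
  let g : A := x * y * (x - y) * (x + y - s * y) in
  let e : ideal A := ideal_gen [:: x ^+ n; y ^+ n; g] in
  let f : A := \sum_(2 <= j < n) (-1) ^+ j * x ^+ (n + 1 - j) * y ^+ j in
  let h : ideal A := ideal_add e (ideal_gen [:: f]) in
  let b : ideal A := ideal_exp (ideal_gen [:: x; y]) (n + 2) in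
  (* (1) *) {subset b <= e} /\
  (* (2) *) (s * f \in e /\ {subset h <= colon e s}) /\
  (* (3) *) ([/\ x * f \in e, y * f \in e & {subset mm <= colon e f}]) /\
  (* (4) *) ([/\ f \notin e, ~ (colon e f =i predT) & mm =i colon e f]) /\
  (* (5) *) colon h s =i h /\
  (* (6) *) (saturI e mm =i satur e s /\ satur e s =i h) /\
  (* (7) *) exists phi : {linear H0 mm (quotmod e) -> quotmod mm},
              bijective phi.
Proof.
case: m hm hchar => // m _ hchar n A s x y mm g e f h b.
have nE : n = (2 * m.+1).+1 by rewrite /n addn1.
have char_m : m.+1%:R != 0 :> k.
  apply/negP => m0; have [p pk] := natf0_pchar (ltn0Sn m) m0.
  by have := hchar p pk; rewrite (dvdn_pcharf pk) m0.
have b_e : {subset b <= e}.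
  move=> a; apply: ideal_exp_gen2 => i id.
  by apply: high_monomial_in_e; rewrite subnKC.
have sf : s * f \in e := sf_in_e s x y nE.
have lin_f u v : (u * x + v * y) * f \in e := linear_f_in_e s x y n u v.
have mm_f a : a \in mm -> a * f \in e.
  move=> /mem_gen3[u [v [w ->]]]; rewrite -addrA mulrDl idealD //.
  by rewrite -mulrA idealM.
have f_e : f \notin e := f_notin_e nE char_m.
have mm_colon : mm =i colon e f.
  (* Every class modulo m is represented by a scalar, which is zero or invertible. *)
  apply: colon_eq_maximal => // a; have [c ac] := mpoly3_mod_origin a.
  exists c%:MP => //; have [->|c0] := eqVneq c 0; [by left; rewrite rmorph0 | right].
  by exists c^-1%:MP; rewrite -rmorphM mulVf // rmorph1.
have h_s : {subset h <= colon e s}.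
  by move=> a ah; apply: ideal_add1_mul ah sf.
have e_h a : a \in e -> a \in h by exact: e_sub_h.
have h_sat a : s * a \in h -> a \in h by exact: (saturated_h nE char_m).
have satur_h : satur e s =i h.
  move=> a; apply/asboolP/idP => [[i _]|ah]; last by exists 1; rewrite // h_s.
  rewrite /colon unfold_in => /e_h; elim: i => [|i IHi]; first by rewrite mulr1.
  by rewrite exprS mulrCA => /h_sat.
(* One inclusion holds because s^i lies in m^i; for the other, exponent 1 suffices, since m h is
   contained in e. *)
have saturI_s : saturI e mm =i satur e s.
  move=> a; apply/idP/idP => [/asboolP[i i0 /asboolP ai]|].
    apply/asboolP; exists i => //; apply: ai; apply: exp_mem_ideal_exp.
    by apply/mem_gen3; exists 1, 0, 0; rewrite !mul0r mul1r !addr0.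
  rewrite satur_h => ah; apply/asboolP; exists 1 => //.
  by apply/asboolP => b' /ideal_exp1 /mm_f; exact: ideal_add1_mul ah.
split=> //; split=> //; split.
  split; last by move=> a; rewrite mm_colon.
  - by have := lin_f 1 0; rewrite mul1r mul0r addr0.
  - by have := lin_f 0 1; rewrite mul1r mul0r add0r.
split.
  split=> // /(_ 1) fe; have : 1 * f \in e by exact: etrans fe _.
  by rewrite mul1r (negPf f_e).
split.
  move=> a; apply/idP/idP => [|ah]; last by have := idealM s ah; rewrite mulrC.
  by rewrite -[_ \in colon _ _]/(a * s \in h) mulrC => /h_sat.
split=> //.
by apply: torsion_quotmod_iso => // a; rewrite saturI_s satur_h.
Qed.
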